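(* Let $n\geqslant 6$, let $i$ be an integer with $1<i<n-2$, $i\neq 2$, and let $G$ be a connected graph of order $n$. Then $G$ realizes $S_{\{i,n-2\}_n^{2}}$ if and only if $G=K_1\vee \left(K_{1}\cup H\right)$, where $H$ is a graph on $n-2$ vertices realizing $S_{\{i-1,n-3\}_{n-2}^{1}}$.
   Context: For a simple graph $G$, its Laplacian spectrum is the multiset of eigenvalues of $L(G)=D-A$. For integers $0<i<j\leqslant n$ and $m\in\{1,\dots,n\}\setminus\{i,j\}$, $S_{\{i,j\}_{n}^{m}}$ denotes the multiset $\{0,1,\ldots,m-1,m,m,m+1,\ldots,n\}\setminus\{i,j\}$. A graph realizes a multiset $S$ if it is simple, connected, and its Laplacian spectrum (with multiplicities) equals $S$. $K_1$ is a single vertex, $\cup$ disjoint union, $X\vee Y$ the join (disjoint union plus all edges between $X$ and $Y$). *)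

(* Defs.v *)
From mathcomp Require Import all_boot all_order all_algebra all_field.
From mathcomp Require Import finmap multiset.

Set Implicit Arguments.
Unset Strict Implicit.
Unset Printing Implicit Defensive.

Import Order.TTheory GRing.Theory Num.Theory.
Local Open Scope ring_scope.
Local Open Scope mset_scope.

Record sgraph : Type := SGraph {
  vertex :> finType;
  adj : rel vertex;
  adj_sym : symmetric adj;
  adj_irrefl : irreflexive adj }.

Definition connected (G : sgraph) : Prop :=
  (0 < #|G|)%N /\ forall x y : G, connect (@adj G) x y.

Definition isomorphic (G H : sgraph) : Prop :=
  exists2 f : G -> H, bijective f & forall x y, adj (f x) (f y) = adj x y.

Section Constructions.
Variables X Y : sgraph.

Definition disjoint_union_adj (u v : X + Y) : bool :=
  match u, v with
  | inl x, inl x' => adj x x'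
  | inr y, inr y' => adj y y'
  | _, _ => false
  end.

Fact disjoint_union_sym : symmetric disjoint_union_adj.
Proof. by move=> [x|y] [x'|y'] //=; rewrite adj_sym. Qed.

Fact disjoint_union_irrefl : irreflexive disjoint_union_adj.
Proof. by move=> [x|y] /=; rewrite adj_irrefl. Qed.

Definition disjoint_union : sgraph :=
  SGraph disjoint_union_sym disjoint_union_irrefl.

Definition join_adj (u v : X + Y) : bool :=
  match u, v with
  | inl x, inl x' => adj x x'
  | inr y, inr y' => adj y y'
  | _, _ => true
  end.

Fact join_sym : symmetric join_adj.
Proof. by move=> [x|y] [x'|y'] //=; rewrite adj_sym. Qed.

Fact join_irrefl : irreflexive join_adj.
Proof. by move=> [x|y] /=; rewrite adj_irrefl. Qed.

Definition join : sgraph := SGraph join_sym join_irrefl.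

End Constructions.

Fact K1_sym : symmetric (fun _ _ : unit => false).
Proof. by []. Qed.

Fact K1_irrefl : irreflexive (fun _ : unit => xpred0 : pred unit).
Proof. by []. Qed.

Definition K1 : sgraph := SGraph K1_sym K1_irrefl.

Section Laplacian.
Variable G : sgraph.

Definition degree (x : G) : nat := #|[pred y | adj x y]|.

Definition degree_mx : 'M[algC]_#|G| :=
  diag_mx (\row_i (degree (enum_val i))%:R).

Definition adjacency_mx : 'M[algC]_#|G| :=
  \matrix_(i, j) (adj (enum_val i) (enum_val j))%:R.

Definition laplacian : 'M[algC]_#|G| := degree_mx - adjacency_mx.

End Laplacian.

(* The eigenvalues are counted with algebraic multiplicity: they are the roots
   of the characteristic polynomial. *)
Definition spectrum (n : nat) (A : 'M[algC]_n) : {mset algC} :=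
  seq_mset (sval (closed_field_poly_normal (char_poly A))).

Lemma char_poly_spectrum n (A : 'M[algC]_n) :
  char_poly A = \prod_(a <- spectrum A) ('X - a%:P).
Proof.
rewrite /spectrum (perm_big _ (perm_eq_seq_mset _)) /=.
case: closed_field_poly_normal => s /= ->.
by rewrite (monicP (char_poly_monic A)) scale1r.
Qed.

Definition realizes (G : sgraph) (S : {mset algC}) : Prop :=
  connected G /\ spectrum (laplacian G) = S.

(* {0, ..., n} with m repeated, minus i and j; meant for 0 < i < j <= n and
   m in {1, ..., n} different from i and j. *)
Definition Sset (i j n m : nat) : {mset algC} :=
  seq_mset [seq k%:R | k <- m :: iota 0 n.+1] `\` [mset i%:R; j%:R].

(* Main.v *)
Require Import Defs.
From mathcomp Require Import all_boot all_order all_fingroup all_algebra all_field.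
From mathcomp Require Import finmap multiset zify ring.

(* The complement of G has Laplacian eigenvalue 0 with a nonconstant
   eigenfunction (from the eigenvalue n of G) and n - 1 (from the eigenvalue 1).
   A disconnected graph of order m with eigenvalue m - 1 has an isolated vertex,
   because the eigenvalues of a component are at most its order; so G has a
   universal vertex v. In G - v, which has order n - 1, the eigenvalues 1 and
   n - 1 of G become 0 (again with a nonconstant eigenfunction) and n - 2, so
   G - v in turn has an isolated vertex. The spectra of G and H then determine
   each other through
   char G (X) = X (X - n) char H (X - 1), and H is connected because its order
   n - 2 is an eigenvalue, which disconnects its complement. *)

Set Implicit Arguments.
Unset Strict Implicit.
Unset Printing Implicit Defensive.

Import Order.TTheory GRing.Theory Num.Theory.

(** * Laplacian eigenfunctions, as functions on the vertices *)

Section Eigenfunctions.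
Local Open Scope ring_scope.
Variable T : finType.
Implicit Types (a : rel T) (x y : T -> algC) (l : algC) (C : {set T}).

(** Written with differences so that loops contribute nothing: [fun u v => ~~ a u v] can then serve
    as the complement, although it is reflexive for a simple graph. *)
Definition laplace a x (u : T) : algC :=
  \sum_v (a u v)%:R * (x u - x v).

Definition eigenfunction a l x : Prop :=
  (exists u, x u != 0) /\ forall u, laplace a x u = l * x u.

(** The right side is twice a double sum; exchanging [u] and [v] in one of the two copies turns
    [(x u)^*] into [(x u - x v)^*]. *)
Lemma dirichlet_form (w : T -> T -> algC) C x :
    (forall u v, w u v = w v u) ->
  \sum_(u in C) \sum_(v in C) w u v * `|x u - x v| ^+ 2 =
  2 * \sum_(u in C) (x u)^* * \sum_(v in C) w u v * (x u - x v).
Proof.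
move=> w_sym; pose E := \sum_(u in C) \sum_(v in C) w u v * (x u - x v) * (x u)^*.
have -> : \sum_(u in C) (x u)^* * \sum_(v in C) w u v * (x u - x v) = E.
  by apply: eq_bigr => u _; rewrite mulr_sumr; apply: eq_bigr => v _; rewrite mulrC.
have EC : E = \sum_(u in C) \sum_(v in C) w v u * (x v - x u) * (x v)^*.
  by rewrite /E exchange_big.
rewrite mulr_natl mulr2n {2}EC -big_split /=.
apply: eq_bigr => u _; rewrite -big_split /=; apply: eq_bigr => v _.
rewrite normCK rmorphB /= (w_sym v u) -!mulrA -mulrDr -(opprB (x u) (x v)).
by rewrite mulNr -mulrBr.
Qed.

(** The Dirichlet form of a kernel function is 0 and its terms are nonnegative, so each of them
    vanishes. *)
Lemma kernel_edge a x u v :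
  symmetric a -> eigenfunction a 0 x -> a u v -> x u = x v.
Proof.
move=> a_sym [_ x0] auv.
have w_sym s t : (a s t)%:R = (a t s)%:R :> algC by rewrite a_sym.
have := dirichlet_form [set: T] x w_sym.
rewrite [X in _ = _ * X]big1 ?mulr0 => [|s _]; last first.
  rewrite (eq_bigl xpredT) => [|t]; last by rewrite inE.
  by have := x0 s; rewrite /laplace mul0r => ->; rewrite mulr0.
have ge0 s t : 0 <= (a s t)%:R * `|x s - x t| ^+ 2.
  by rewrite mulr_ge0 ?ler0n ?exprn_ge0.
move/psumr_eq0P => /(_ (fun s _ => sumr_ge0 _ (fun t _ => ge0 s t))).
move=> /(_ u (in_setT u)) /psumr_eq0P => /(_ (fun t _ => ge0 u t)).
move=> /(_ v (in_setT v)); rewrite auv mul1r => /eqP.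
by rewrite expf_eq0 normr_eq0 subr_eq0 => /eqP.
Qed.

(** By symmetry the values of [laplace a x] add up to 0. *)
Lemma eigenfunction_sum0 a l x :
  symmetric a -> l != 0 -> eigenfunction a l x -> \sum_u x u = 0.
Proof.
move=> a_sym l0 [_ xl]; apply: (mulfI l0); rewrite mulr0 mulr_sumr.
under eq_bigr do rewrite -xl /laplace.
under eq_bigr do under eq_bigr do rewrite mulrBr.
under eq_bigr do rewrite sumrB.
rewrite sumrB [X in _ - X]exchange_big /=.
apply/eqP; rewrite subr_eq0; apply/eqP.
by apply: eq_bigr => u _; apply: eq_bigr => v _; rewrite a_sym.
Qed.

(** The Laplacians of a graph and of its complement add up to that of the complete graph, which
    multiplies a function of sum 0 by [#|T|]. *)
Lemma eigenfunction_compl a l x :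
    \sum_u x u = 0 -> eigenfunction a l x ->
  eigenfunction (fun u v => ~~ a u v) (#|T|%:R - l) x.
Proof.
move=> x0 [nz xl]; split=> // u.
rewrite mulrBl -xl; apply/eqP; rewrite eq_sym subr_eq; apply/eqP.
rewrite /laplace -big_split /=.
transitivity (\sum_v (x u - x v)).
  by rewrite sumrB x0 subr0 sumr_const mulr_natl.
by apply: eq_bigr => v _; rewrite -mulrDl; case: (a u v); rewrite ?addr0 ?add0r mul1r.
Qed.

(* Compares the Dirichlet form of [a] on [C] with that of the complete graph
   on [C], whose largest eigenvalue is [#|C|]. *)
Lemma eigenvalue_le_closed a k x C u :
    symmetric a -> eigenfunction a k%:R x ->
    (forall s t, s \in C -> a s t -> t \in C) ->
  u \in C -> x u != 0 -> (k <= #|C|)%N.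
Proof.
move=> a_sym [_ xk] C_closed uC xu.
have w_sym s t : (a s t)%:R = (a t s)%:R :> algC by rewrite a_sym.
have Ea := dirichlet_form C x w_sym.
have E1 := @dirichlet_form (fun _ _ => 1) C x (fun _ _ => erefl).
pose N := \sum_(s in C) (x s)^* * x s.
have N_gt0 : 0 < N.
  rewrite /N (bigD1 u) //= ltr_wpDr //; last first.
    by rewrite mulrC -normCK exprn_gt0 ?normr_gt0.
  by apply: sumr_ge0 => s _; rewrite mulrC -normCK exprn_ge0.
(* No edge leaves [C], so for vertices in [C] the inner sum over [C] is the whole Laplacian. *)
have {}Ea : \sum_(s in C) \sum_(t in C) (a s t)%:R * `|x s - x t| ^+ 2 = 2 * (k%:R * N).
  rewrite Ea /N; congr (2 * _); rewrite mulr_sumr; apply: eq_bigr => s sC.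
  rewrite mulrCA; congr (_ * _); rewrite -xk /laplace big_mkcond /=.
  apply: eq_bigr => t _; case: ifP => // tC.
  by case ast: (a s t); [rewrite (C_closed s t) in tC | rewrite mul0r].
(* The two sides differ by twice the squared modulus of the sum of [x] over [C]. *)
have {}E1 : \sum_(s in C) \sum_(t in C) 1 * `|x s - x t| ^+ 2 <= 2 * (#|C|%:R * N).
  rewrite E1 ler_pM2l ?ltr0n // /N mulr_sumr.
  set S := \sum_(t in C) x t.
  rewrite (eq_bigr (fun s => #|C|%:R * ((x s)^* * x s) - (x s)^* * S)).
    rewrite sumrB gerBl -mulr_suml -rmorph_sum /= -/S mulrC -normCK.
    by rewrite exprn_ge0.
  move=> s sC; under eq_bigr do rewrite mul1r.
  by rewrite sumrB sumr_const -/S mulrBr -(mulr_natl (x s)) mulrCA.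
have : 2 * (k%:R * N) <= 2 * (#|C|%:R * N).
  rewrite -Ea; apply: le_trans E1; apply: ler_sum => s _; apply: ler_sum => t _.
  by apply: ler_wpM2r; [rewrite exprn_ge0 | rewrite lern1 leq_b1].
by rewrite ler_pM2l ?ltr0n // ler_pM2r // ler_nat.
Qed.

Lemma eigenfunction_nonconst x c :
  (exists u, x u != 0) -> \sum_u x u = 0 -> exists u, x u != c.
Proof.
move=> [u xu] x0; apply/existsP; apply: contraNT xu.
rewrite negb_exists => /forallP xc.
have {}xc s : x s = c by apply/eqP; have := xc s; rewrite negbK.
rewrite xc; move: x0; under eq_bigr do rewrite xc.
rewrite sumr_const => /eqP; rewrite mulrn_eq0 => /orP[|//].
by rewrite (cardD1 u).
Qed.

(** A level set of the kernel function [x] is a union of components. One through a vertex where [y]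
    is nonzero has at least [#|T|.-1] elements; as [x] is not constant, exactly one vertex lies
    outside, and a neighbour of it would lie outside too. *)
Lemma isolated_vertex a x y :
    symmetric a -> eigenfunction a 0 x -> \sum_u x u = 0 ->
    eigenfunction a (#|T|.-1)%:R y ->
  exists w, forall u, u != w -> ~~ a w u.
Proof.
move=> a_sym Ex x0 Ey; have [[u yu] _] := Ey.
pose C := [set s | x s == x u].
have C_closed s t : s \in C -> a s t -> t \in C.
  by rewrite !inE => /eqP <- /(kernel_edge a_sym Ex) ->.
have uC : u \in C by rewrite inE.
have cardC := eigenvalue_le_closed a_sym Ey C_closed uC yu.
have [w wC] := eigenfunction_nonconst (x u) Ex.1 x0.
have wC' : w \in ~: C by rewrite !inE.
exists w => s sw; apply/negP => aws.
have sC : s \in ~: C by rewrite !inE -(kernel_edge a_sym Ex aws).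
have : (#|[set w; s]| <= #|~: C|)%N.
  by apply/subset_leq_card/subsetP => t /set2P[] ->.
rewrite cards2 eq_sym sw => lt1.
have T0 : (0 < #|T|)%N by rewrite (cardD1 u).
have := leq_add cardC lt1; rewrite cardsC -ltnS.
by case: #|T| T0 => // n _ /=; rewrite addn2 ltnS ltnn.
Qed.

End Eigenfunctions.

(** * Characteristic polynomials of permuted, shifted and bordered matrices *)

Section CharPoly.
Local Open Scope ring_scope.

(** [m] and [n] are separate variables so that vertices can be renumbered between index types that
    are only provably equal. *)
Lemma char_poly_mxsub (R : comNzRingType) m n (g : 'I_m -> 'I_n) (A : 'M[R]_n) :
  bijective g -> char_poly (mxsub g g A) = char_poly A.
Proof.
move=> g_bij; have mn : m = n.
  by rewrite -[m]card_ord -[n]card_ord; apply: bij_eq_card g_bij.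
subst n; have g_inj := bij_inj g_bij; pose s := perm g_inj.
have -> : mxsub g g A = row_perm s (col_perm s A).
  by apply/matrixP => i j; rewrite !mxE !permE.
rewrite /char_poly.
have -> : char_poly_mx (row_perm s (col_perm s A)) =
    row_perm s (col_perm s (char_poly_mx A)).
  by apply/matrixP => i j; rewrite !mxE (inj_eq perm_inj).
rewrite row_permE col_permE !det_mulmx !det_perm mulrCA.
by rewrite odd_permV -signr_addb addbb mulr1.
Qed.

Lemma char_poly_shift (R : comNzRingType) n (A : 'M[R]_n) c :
  char_poly A \Po ('X - c%:P) = char_poly (c%:M + A).
Proof.
rewrite /char_poly -det_map_mx; congr (\det _); apply/matrixP => i j.
rewrite !mxE rmorphB rmorphMn /= comp_polyX comp_polyC polyCD polyCMn.
by rewrite mulrnBl opprD addrA.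
Qed.

(* Left multiplication by the block matrix [[X - 1, -1], [0, I]], of determinant
   X - 1, clears the off-diagonal part of the first row. *)
Lemma char_poly_cone (R : comNzRingType) m (L : 'M[R]_m) :
    const_mx 1 *m L = 0 :> 'rV_m ->
  ('X - 1%:P) *
    char_poly (block_mx (m%:R%:M : 'M_1) (const_mx (-1)) (const_mx (-1)) (1%:M + L)) =
  'X * ('X - m.+1%:R%:P) * (char_poly L \Po ('X - 1%:P)).
Proof.
move=> L0; rewrite char_poly_shift /char_poly; set B := char_poly_mx (1%:M + L).
pose e : 'rV[{poly R}]_m := const_mx 1.
(* The zero column sums of [L] make the all-ones row a left eigenvector of [B], which cancels the
   upper right block of the product of [N] and [M]. *)
have eB : e *m B = ('X - 1) *: e.
  rewrite /B /char_poly_mx map_mxD map_scalar_mx mulmxBr mulmxDr !mul_mx_scalar.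
  rewrite (_ : e = map_mx polyC (const_mx 1)); last by rewrite map_const_mx.
  by rewrite -map_mxM L0 map_mx0 addr0 scalerBl.
pose N : 'M_(1 + m) := block_mx ('X - 1)%:M (- e) 0 1%:M.
pose M := block_mx ('X - m%:R)%:M e e^T B.
have -> : char_poly_mx (block_mx m%:R%:M (const_mx (-1)) (const_mx (-1)) (1%:M + L)) = M.
  rewrite /char_poly_mx map_block_mx scalar_mx_block opp_block_mx add_block_mx.
  rewrite /M /B /e !sub0r !map_const_mx map_scalar_mx rmorph_nat -raddfB /=.
  by congr block_mx; apply/matrixP => i j; rewrite !mxE rmorphN1 opprK.
have <- : \det N = 'X - 1%:P by rewrite det_ublock det1 mulr1 det_scalar1.
rewrite -det_mulmx /N /M mulmx_block !mul0mx !mul1mx !add0r !mulNmx eB.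
rewrite !mul_scalar_mx subrr det_lblock; congr (_ * _).
(* The corner entry is (X - 1)(X - m) - m = X (X - (m + 1)). *)
rewrite det_mx11 !mxE eqxx mulr1n.
rewrite (eq_bigr (fun=> 1)) => [|i _]; last by rewrite !mxE mulr1.
rewrite sumr_const card_ord polyC_natr -natr1; ring.
Qed.

End CharPoly.

(** * Laplacian characteristic polynomials of joins and unions with a vertex *)

Section Laplacian.
Local Open Scope ring_scope.
Implicit Types G H X : sgraph.

Lemma degreeE G (u : G) : degree u = (\sum_v adj u v)%N.
Proof.
rewrite /degree -sum1_card big_mkcond; apply: eq_bigr => v _.
by rewrite inE; case: adj.
Qed.

(** Indexed by vertices, so that any numbering of them can be used to write the matrix. *)
Definition lap G (u v : G) : algC := (degree u)%:R *+ (u == v) - (adj u v)%:R.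

Lemma laplacianE G i j : laplacian G i j = lap (enum_val i) (enum_val j).
Proof. by rewrite !mxE /lap (inj_eq enum_val_inj). Qed.

Lemma sum_lap G (u : G) (x : G -> algC) :
  \sum_v lap u v * x v = laplace (@adj G) x u.
Proof.
rewrite /lap /laplace; under eq_bigr do rewrite mulrBl.
under [RHS]eq_bigr do rewrite mulrBr.
rewrite !sumrB; congr (_ - _).
rewrite (bigD1 u) //= big1 => [|v /negPf vu]; last by rewrite eq_sym vu mul0r.
by rewrite addr0 eqxx degreeE natr_sum mulr_suml.
Qed.

Lemma lap_sym G (u v : G) : lap u v = lap v u.
Proof. by rewrite /lap adj_sym eq_sym; case: eqP => // ->. Qed.

Lemma laplacian_colsum0 G : const_mx 1 *m laplacian G = 0 :> 'rV_#|G|.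
Proof.
apply/matrixP => i j; rewrite !mxE.
pose v := enum_val j; transitivity (\sum_u lap v u * (fun=> 1) u).
  rewrite [RHS](reindex _ (onW_bij _ (@enum_val_bij G))) /=.
  by apply: eq_bigr => k _; rewrite mxE mul1r mulr1 laplacianE lap_sym.
rewrite sum_lap /laplace big1 // => u _; by rewrite subrr mulr0.
Qed.

Lemma laplacian_eigenfunction G (l : algC) :
  root (char_poly (laplacian G)) l -> exists x, eigenfunction (@adj G) l x.
Proof.
rewrite -eigenvalue_root_char => /eigenvalueP[v vL v0].
exists (fun u => v 0 (enum_rank u)); split.
  have /rV0Pn[i vi] := v0; exists (enum_val i); by rewrite enum_valK.
move=> u; rewrite -sum_lap; have /matrixP/(_ 0 (enum_rank u)) := vL.
rewrite !mxE => <-; rewrite [LHS](reindex _ (onW_bij _ (@enum_val_bij G))) /=.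
apply: eq_bigr => k _.
(* [eigenvalueP] provides a row vector, so symmetry is needed to read it as an eigenfunction. *)
by rewrite laplacianE enum_rankK enum_valK mulrC lap_sym.
Qed.

Lemma char_poly_laplacian_reindex m G (h : 'I_m -> G) :
  bijective h ->
  char_poly (laplacian G) = char_poly (\matrix_(i, j) lap (h i) (h j)).
Proof.
move=> h_bij; rewrite -(char_poly_mxsub (g := enum_rank \o h)).
  by congr char_poly; apply/matrixP => i j; rewrite mxE laplacianE mxE !enum_rankK.
by apply: bij_comp h_bij; apply: enum_rank_bij.
Qed.

Lemma char_poly_laplacian_iso G H :
  isomorphic G H -> char_poly (laplacian G) = char_poly (laplacian H).
Proof.
move=> [f f_bij f_adj].
rewrite (char_poly_laplacian_reindex (@enum_val_bij G)).
rewrite (char_poly_laplacian_reindex (bij_comp f_bij (@enum_val_bij G))).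
congr char_poly; apply/matrixP => i j; rewrite !mxE /= /lap f_adj.
rewrite (inj_eq (bij_inj f_bij)) !degreeE [in RHS](reindex f (onW_bij _ f_bij)) /=.
by congr (_%:R *+ _ - _); apply: eq_bigr => v _; rewrite f_adj.
Qed.

(** Numbers the vertex of [K1] first, which puts the Laplacians of joins and unions with [K1] in
    block form. *)
Definition sum_enum_val X (i : 'I_(1 + #|X|)) : unit + X :=
  match split i with inl _ => inl tt | inr j => inr (enum_val j) end.

Lemma sum_enum_val_bij X : bijective (@sum_enum_val X).
Proof.
pose r (u : unit + X) : 'I_(1 + #|X|) :=
  match u with inl _ => lshift _ ord0 | inr x => rshift 1 (enum_rank x) end.
exists r => [i|[[]|x]]; rewrite /sum_enum_val /r.
- by case: split_ordP => j ->; rewrite ?enum_valK ?[j]ord1.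
- by case: split_ordP => j // /eqP; rewrite eq_lrshift.
- case: split_ordP => j /eqP; rewrite ?eq_rlshift ?eq_rshift // => /eqP <-.
  by rewrite enum_rankK.
Qed.

(** For nonempty [X], the join raises the eigenvalues of [X] by 1, except that the 0 of the
    constants is replaced by 0 and [#|X|.+1]; the factor ['X - 1%:P] on the left spares a
    division. *)
Lemma char_poly_join_K1 X :
  ('X - 1%:P) * char_poly (laplacian (join K1 X)) =
  'X * ('X - #|X|.+1%:R%:P) * (char_poly (laplacian X) \Po ('X - 1%:P)).
Proof.
rewrite -char_poly_cone ?laplacian_colsum0 //.
rewrite (char_poly_laplacian_reindex
  (@sum_enum_val_bij X : bijective (_ : _ -> join K1 X))).
congr (_ * char_poly _); apply/matrixP => i j; rewrite mxE /lap /sum_enum_val.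
case: (split_ordP i) => i' ->; case: (split_ordP j) => j' ->.
- rewrite block_mxEul mxE !ord1 !eqxx subr0 !mulr1n degreeE big_sumType /=.
  by rewrite big1 // add0n sum1_card.
- by rewrite block_mxEur mxE sub0r.
- by rewrite block_mxEdl mxE sub0r.
rewrite block_mxEdr !mxE !degreeE big_sumType /= sum1_card card_unit.
rewrite (inj_eq (inr_inj)) (inj_eq enum_val_inj) natrD mulrnDl addrA.
by rewrite -!degreeE.
Qed.

Lemma char_poly_disjoint_union_K1 X :
  char_poly (laplacian (disjoint_union K1 X)) = 'X * char_poly (laplacian X).
Proof.
rewrite (char_poly_laplacian_reindex
  (@sum_enum_val_bij X : bijective (_ : _ -> disjoint_union K1 X))).
transitivity (char_poly (block_mx (0 : 'M_1) 0 0 (laplacian X))); last first.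
  rewrite /char_poly char_block_diag_mx det_ublock; congr (_ * _).
  by rewrite det_mx11 !mxE subr0 eqxx.
congr (char_poly _); apply/matrixP => i j; rewrite mxE /lap /sum_enum_val.
case: (split_ordP i) => i' ->; case: (split_ordP j) => j' ->.
- by rewrite block_mxEul mxE degreeE big_sumType /= !big1 // mul0rn subr0.
- by rewrite block_mxEur mxE subr0.
- by rewrite block_mxEdl mxE subr0.
rewrite block_mxEdr !mxE !degreeE big_sumType /= big1 // add0n.
by rewrite (inj_eq (inr_inj)) (inj_eq enum_val_inj).
Qed.

(** The isolated vertex contributes a factor X, which the shift turns into X - 1; this cancels the
    extra factor of the join formula. *)
Lemma char_poly_K1_join_union H :
  char_poly (laplacian (join K1 (disjoint_union K1 H))) =
  'X * ('X - #|H|.+2%:R%:P) * (char_poly (laplacian H) \Po ('X - 1%:P)).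
Proof.
apply: (mulfI (monic_neq0 (monicXsubC 1))).
rewrite char_poly_join_K1 char_poly_disjoint_union_K1 comp_polyM comp_polyX.
rewrite card_sum card_unit add1n; ring.
Qed.

End Laplacian.

(** * From characteristic polynomials to the multisets [Sset] *)

Section Spectra.
Local Open Scope mset_scope.
Local Open Scope ring_scope.

Lemma spectrum_eqP n (A : 'M[algC]_n) (S : {mset algC}) :
  spectrum A = S <-> char_poly A = \prod_(a <- S) ('X - a%:P).
Proof.
split=> [<-|]; first exact: char_poly_spectrum.
rewrite char_poly_spectrum => /prod_XsubC_eq /eq_seq_msetP.
by rewrite !seq_mset_id.
Qed.

Lemma count_Sset_base n m k : (k <= n)%N ->
  (0 < count_mem (k%:R : algC) [seq l%:R | l <- m :: iota 0 n.+1])%N.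
Proof.
move=> kn; rewrite -has_count has_pred1; apply: (map_f (fun l => l%:R : algC)).
by rewrite inE mem_iota add0n ltnS kn orbT.
Qed.

Lemma mem_Sset i j n m k :
  (k <= n)%N -> k != i -> k != j -> k%:R \in Sset i j n m.
Proof.
move=> kn ki kj; rewrite in_mset /Sset msetE2 mset_seqE mset1DE msetnE !eqr_nat.
by rewrite (negPf ki) (negPf kj) subn0 count_Sset_base.
Qed.

(** Multiplying the removed factors back in replaces the multiset difference by a polynomial
    identity. *)
Lemma prod_Sset i j n m : (i <= n)%N -> (j <= n)%N -> i != j ->
  ('X - i%:R%:P) * ('X - j%:R%:P) * \prod_(a <- Sset i j n m) ('X - a%:P) =
  ('X - m%:R%:P) * \prod_(k < n.+1) ('X - k%:R%:P) :> {poly algC}.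
Proof.
move=> i_n j_n ij.
have perm_S : perm_eq [:: i%:R, j%:R & Sset i j n m] [seq k%:R | k <- m :: iota 0 n.+1].
  apply/allP => x _; rewrite /= count_mem_mset /Sset msetE2 mset_seqE mset1DE msetnE.
  rewrite ![x == _]eq_sym addnA -/(count_mem x [seq k%:R | k <- m :: iota 0 n.+1]).
  rewrite -[if _ then _ else _]/(nat_of_bool _).
  (* The truncated difference is exact because [i] and [j] are distinct and both occur in the base
     list. *)
  rewrite subnKC //; case: (eqVneq i%:R x) => [<-|_].
    by rewrite eqr_nat eq_sym (negPf ij) addn0 count_Sset_base.
  by case: (eqVneq j%:R x) => [<-|//]; rewrite count_Sset_base.
have : \prod_(a <- [:: i%:R, j%:R & Sset i j n m]) ('X - a%:P) =
    \prod_(a <- [seq k%:R | k <- m :: iota 0 n.+1]) ('X - a%:P) :> {poly algC}.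
  exact: perm_big.
rewrite 2!big_cons mulrA => ->; rewrite map_cons big_cons big_map.
by rewrite -(big_mkord xpredT (fun k => 'X - k%:R%:P)) /index_iota subn0.
Qed.

Lemma comp_poly_subX_inj (R : nzRingType) (c : R) :
  injective (comp_poly ('X - c%:P)).
Proof.
apply: (can_inj (g := comp_poly ('X + c%:P))) => p.
by have := comp_polyXaddC_K p (- c); rewrite polyCN opprK.
Qed.

(** Raising 0, ..., n by 1 gives 1, ..., n + 1; the missing ends 0 and n + 2 supply the two extra
    factors. *)
Lemma prod_Sset_shift i j n m : (i <= n)%N -> (j <= n)%N -> i != j ->
  \prod_(a <- Sset i.+1 j.+1 n.+2 m.+1) ('X - a%:P) =
  'X * ('X - n.+2%:R%:P) *
    ((\prod_(a <- Sset i j n m) ('X - a%:P)) \Po ('X - 1%:P)) :> {poly algC}.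
Proof.
move=> i_n j_n ij; set P := \prod_(a <- Sset i j n m) _.
have shift (k : nat) : ('X - k%:R%:P) \Po ('X - 1%:P) = 'X - k.+1%:R%:P :> {poly algC}.
  by rewrite comp_polyB comp_polyX comp_polyC -natr1 polyCD; ring.
have nz (k : nat) : 'X - k%:R%:P != 0 :> {poly algC} by rewrite monic_neq0 ?monicXsubC.
(* Both sides are multiplied by the factors of the removed elements, so that [prod_Sset] applies. *)
apply: (mulfI (mulf_neq0 (nz i.+1) (nz j.+1))).
rewrite prod_Sset ?eqSS ?ltnS ?(leqW i_n) ?(leqW j_n) //.
have := congr1 (comp_poly ('X - 1%:P)) (prod_Sset m i_n j_n ij).
rewrite -/P; move: P => P; rewrite !comp_polyM !shift rmorph_prod /=.
under eq_bigr do rewrite shift.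
rewrite [in X in _ -> X]big_ord_recl [in X in _ -> X]big_ord_recr /= subr0.
rewrite /bump add1n; under [in X in _ -> X]eq_bigr do rewrite add1n.
move=> E; rewrite [RHS]mulrCA E; ring.
Qed.

Lemma spectrum_K1_join_union (H : sgraph) i j n m :
    (i <= n)%N -> (j <= n)%N -> i != j -> #|H| = n ->
  spectrum (laplacian (join K1 (disjoint_union K1 H))) = Sset i.+1 j.+1 n.+2 m.+1
  <-> spectrum (laplacian H) = Sset i j n m.
Proof.
move=> i_n j_n ij cardH; subst n; rewrite !spectrum_eqP char_poly_K1_join_union.
rewrite prod_Sset_shift //; split=> [E|-> //]; apply: comp_poly_subX_inj.
by apply: mulfI E; rewrite mulf_neq0 ?polyX_eq0 ?monic_neq0 ?monicXsubC.
Qed.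

Lemma spectrum_eigenfunction (G : sgraph) S l :
  spectrum (laplacian G) = S -> l \in S -> exists x, eigenfunction (@adj G) l x.
Proof.
move=> specG lS; apply: laplacian_eigenfunction.
by rewrite char_poly_spectrum root_prod_XsubC specG.
Qed.
End Spectra.

(** * Graph structure forced by eigenvalues *)

Section Structure.
Local Open Scope ring_scope.
Implicit Types G H : sgraph.

Definition induced_adj G (P : pred G) : rel {u | P u} := relpre val (@adj G).

Fact induced_sym G (P : pred G) : symmetric (@induced_adj G P).
Proof. by move=> u v; rewrite /induced_adj /= adj_sym. Qed.

Fact induced_irrefl G (P : pred G) : irreflexive (@induced_adj G P).
Proof. by move=> u; rewrite /induced_adj /= adj_irrefl. Qed.

Definition induced G (P : pred G) : sgraph :=
  SGraph (@induced_sym G P) (@induced_irrefl G P).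

Lemma isomorphic_K1_join_union G (v w : G) :
    v != w -> (forall u, u != v -> adj v u) ->
    (forall u, u != v -> ~~ adj w u) ->
  isomorphic G (join K1 (disjoint_union K1 (induced [pred u | u \notin [:: v; w]]))).
Proof.
move=> vw v_univ w_isol; set H := induced _.
(* Going from the join to [G] allows a definition by cases; the inverse of [f] is the required
   isomorphism. *)
pose f (u : unit + (unit + H)) : G :=
  match u with inl _ => v | inr (inl _) => w | inr (inr x) => val x end.
have notvw (x : H) : (val x != v) /\ (val x != w).
  by have /= := valP x; rewrite !inE negb_or => /andP.
have f_inj : injective f.
  move=> [[]|[[]|x]] [[]|[[]|y]] //= E.
  - by rewrite E eqxx in vw.
  - by have [/eqP + _] := notvw y; case.
  - by rewrite E eqxx in vw.
  - by have [_ /eqP] := notvw y; case.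
  - by have [/eqP + _] := notvw x; case.
  - by have [_ /eqP] := notvw x; case.
  - by congr (inr (inr _)); apply: val_inj.
have f_surj u : exists s, f s = u.
  have [->|uv] := eqVneq u v; first by exists (inl tt).
  have [->|uw] := eqVneq u w; first by exists (inr (inl tt)).
  have uP : u \notin [:: v; w] by rewrite !inE negb_or uv.
  by exists (inr (inr (exist _ u uP))).
have f_adj s t : adj (f s) (f t) = adj (s : join K1 (disjoint_union K1 H)) t.
  case: s t => [[]|[[]|x]] [[]|[[]|y]] /=; rewrite ?adj_irrefl //.
  - by rewrite v_univ // eq_sym.
  - by rewrite v_univ //; case: (notvw y).
  - by rewrite adj_sym v_univ // eq_sym.
  - by apply/negbTE/w_isol; case: (notvw y).
  - by rewrite adj_sym v_univ //; case: (notvw x).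
  - by rewrite adj_sym; apply/negbTE/w_isol; case: (notvw x).
have [g fK gK] : bijective f.
  apply: (inj_card_bij f_inj); rewrite -(card_codom f_inj).
  by apply/subset_leq_card/subsetP => u _; have [s <-] := f_surj u; apply: codom_f.
by exists g => [|s t]; [exists f | rewrite -f_adj !gK].
Qed.

(** At [v] the eigenvalue equation reads [#|T|%:R * x v = l * x v], so [x v = 0]. Deleting [v] then
    removes just the term [x u] from the equation at each other vertex [u]. *)
Lemma eigenfunction_remove_universal (T : finType) (a : rel T) l x v :
    (forall u, u != v -> a v u) -> symmetric a ->
    l != #|T|%:R -> \sum_u x u = 0 -> eigenfunction a l x ->
  eigenfunction (relpre (val : {u | u != v} -> T) a) (l - 1) (x \o val) /\
  \sum_(u : {u | u != v}) x (val u) = 0.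
Proof.
move=> v_univ a_sym l_card x0 [[s xs] xl].
have xv : x v = 0.
  have /eqP := xl v; rewrite /laplace.
  rewrite (eq_bigr (fun u => x v - x u)) => [|u _]; last first.
    by case: (eqVneq u v) => [->|/v_univ ->]; rewrite ?mul1r // subrr mulr0.
  rewrite sumrB x0 subr0 sumr_const -mulr_natl -subr_eq0 -mulrBl mulf_eq0 subr_eq0.
  by rewrite eq_sym (negPf l_card) => /eqP.
have sum_val F : F v = 0 -> \sum_(u : {u | u != v}) F (val u) = \sum_u F u :> algC.
  by move=> Fv; rewrite -(big_sub [pred u | u != v]) [RHS](bigD1 v) //= Fv add0r.
split; last by rewrite sum_val.
split=> [|u].
  have sv : s != v by apply: contraNneq xs => ->; rewrite xv.
  by exists (exist _ s sv).
rewrite mulrBl mul1r /= -xl /laplace [in RHS](bigD1 v) //= xv subr0.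
rewrite a_sym v_univ ?(valP u) // mul1r addrAC subrr add0r.
exact/esym/(big_sub [pred u | u != v]).
Qed.

Lemma universal_isolated_vertices G (x y z : G -> algC) :
    eigenfunction (@adj G) #|G|%:R x -> eigenfunction (@adj G) 1 y ->
    eigenfunction (@adj G) #|G|.-1%:R z -> (2 < #|G|)%N ->
  exists v w : G, [/\ v != w, forall u, u != v -> adj v u
    & forall u, u != v -> ~~ adj w u].
Proof.
move=> Ex Ey Ez lt2G; have symG := @adj_sym G.
have sum0 k f : (0 < k)%N -> eigenfunction (@adj G) k%:R f -> \sum_u f u = 0.
  by move=> k0; apply: eigenfunction_sum0 symG _; rewrite pnatr_eq0 -lt0n.
have x0 := sum0 _ _ (ltnW (ltnW lt2G)) Ex; have y0 := sum0 1%N _ isT Ey.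
have z0 : \sum_u z u = 0 by apply: sum0 Ez; rewrite -ltnS prednK // ltnW // ltnW.
have symC : symmetric (fun u v : G => ~~ adj u v) by move=> u v; rewrite symG.
(* In the complement [x] has eigenvalue 0 and [y] has [#|G|%:R - 1]; an isolated vertex there is
   universal in [G]. *)
have Cx := eigenfunction_compl x0 Ex; rewrite subrr in Cx.
have Cy := eigenfunction_compl y0 Ey.
have [|v v_univ] := isolated_vertex symC Cx x0 (y := y).
  by rewrite -subn1 natrB // ltnW // ltnW.
have {}v_univ u : u != v -> adj v u by move/v_univ; rewrite negbK.
have [|Ey' y0'] := eigenfunction_remove_universal v_univ symG _ y0 Ey.
  by rewrite eq_sym pnatr_eq1 neq_ltn (ltn_trans _ lt2G) ?orbT.
have [|Ez' _] := eigenfunction_remove_universal v_univ symG _ z0 Ez.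
  by rewrite eqr_nat neq_ltn prednK ?leqnn // ltnW // ltnW.
rewrite subrr in Ey'.
have sym' : symmetric (relpre (val : {u | u != v} -> G) (@adj G)).
  by move=> s t; apply: symG.
have [|[w wv] /= w_isol] := isolated_vertex sym' Ey' y0' (y := z \o val).
  (* Deleting [v] lowers both the order and the eigenvalue of [z] by 1, so that eigenvalue is again
     the order minus 1. *)
  suff -> : #|{: {u | u != v}}|.-1%:R = #|G|.-1%:R - 1 :> algC by [].
  rewrite card_sig cardC1; case: #|G| lt2G => [|[|k]] //= _.
  by rewrite -natr1 addrK.
exists v, w; split=> // [|u uv]; first by rewrite eq_sym.
have [->|uw] := eqVneq u w; first by rewrite adj_irrefl.
exact: (w_isol (exist _ u uv)).
Qed.

(** Since [x] is a kernel function of the complement, vertices with different values are adjacent.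
    Two vertices with equal values have a common neighbour, as [x] is not constant. *)
Lemma connected_eigenvalue_card H x :
  eigenfunction (@adj H) #|H|%:R x -> connected H.
Proof.
move=> Ex; have [[u0 xu0] _] := Ex.
have H0 : (0 < #|H|)%N by rewrite (cardD1 u0).
split=> // u v; have symH := @adj_sym H.
have x0 : \sum_u x u = 0.
  by apply: eigenfunction_sum0 symH _ Ex; rewrite pnatr_eq0 -lt0n.
have Cx := eigenfunction_compl x0 Ex; rewrite subrr in Cx.
have symC : symmetric (fun u v : H => ~~ adj u v) by move=> s t; rewrite symH.
have adjP s t : x s != x t -> adj s t.
  by apply: contraNT => /(kernel_edge symC Cx) ->.
have [xuv|/adjP/connect1 //] := eqVneq (x u) (x v).
have [w xw] := eigenfunction_nonconst (x u) Ex.1 x0.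
apply: (connect_trans (y := w)); apply/connect1/adjP; first by rewrite eq_sym.
by rewrite -xuv.
Qed.

End Structure.

Theorem theorem4p4 (n i : nat) (G : sgraph)
    (hn : 6 <= n) (hi : 1 < i < n - 2) (hi2 : i != 2)
    (hG : connected G) (hcard : #|G| = n) :
  realizes G (Sset i (n - 2) n 2) <->
  exists H : sgraph,
    [/\ #|H| = n - 2,
        realizes H (Sset (i - 1) (n - 3) (n - 2) 1)
      & isomorphic G (join K1 (disjoint_union K1 H))].
Proof.
(* From here [n] is the order minus 3 and [i] the original index minus 1, so that all subtractions
   compute. *)
case: n i hn hi hi2 hcard => [|[|[|n]]] [|i] // hn hi hi2 hcard.
have {hi hn} [lt0i lt_i_n lt2n] : [/\ 0 < i, i < n & 2 < n] by split; lia.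
rewrite !subn1 !subSS !subn0 /=.
have spec (H : sgraph) : #|H| = n.+1 -> isomorphic G (join K1 (disjoint_union K1 H)) ->
    spectrum (laplacian G) = Sset i.+1 n.+1 n.+3 2 <->
    spectrum (laplacian H) = Sset i n n.+1 1.
  move=> cardH isoG; rewrite -(@spectrum_K1_join_union H) //; try lia.
  by rewrite /spectrum (char_poly_laplacian_iso isoG).
split=> [[_ specG]|[H [cardH [_ specH] isoG]]]; last by split=> //; apply/(spec H).
have eig k : k <= n.+3 -> k != i.+1 -> k != n.+1 ->
    exists x, eigenfunction (@adj G) (k%:R)%R x.
  by move=> *; apply: (spectrum_eigenfunction specG); apply: mem_Sset.
(* The removed values are [i.+1], which lies between 2 and [n], and [n.+1]; hence [n.+3], 1 and
   [n.+2] remain. *)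
have [|||x Ex] := eig n.+3; try lia.
have [|||y Ey] := eig 1; try lia.
have [|||z Ez] := eig n.+2; try lia.
have [||||v [w [vw v_univ w_isol]]] := @universal_isolated_vertices G x y z;
  rewrite ?hcard //.
have isoG := isomorphic_K1_join_union vw v_univ w_isol.
set H := induced _ in isoG; have cardH : #|H| = n.+1.
  have [f f_bij _] := isoG; have := bij_eq_card f_bij.
  by rewrite hcard !card_sum card_unit => -[].
have specH := (spec H cardH isoG).1 specG.
exists H; split=> //; split=> //.
(* As [i < n < #|H|], the order of [H] is not among the values removed from its spectrum. *)
have [x' Ex'] : exists x, eigenfunction (@adj H) (#|H|%:R)%R x.
  by apply: (spectrum_eigenfunction specH); rewrite cardH; apply: mem_Sset; lia.
exact: connected_eigenvalue_card Ex'.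
Qed.
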